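(* Let $\beta>0$ and let $\mathcal{H}=\{(x_i,f_i,g_i)\}_{i\in\mathcal{I}}$ be any set of observations with $x_i,g_i\in\mathbb{R}^d$, $f_i\in\mathbb{R}$. The following are equivalent: (i) $\mathcal{H}$ is interpolable by a convex $(\beta,0)$-Hölder smooth function; (ii) $\mathcal{H}$ is $L(\cdot)$-interpolable with $L(\delta)=\frac{\beta^2}{2\delta}$; (iii) for all $i,j\in\mathcal{I}$, $f_i\ge f_j+\langle g_j,x_i-x_j\rangle$ and $\|g_i-g_j\|\le\beta$.
   Context: Functions are closed, convex, proper $f:\mathbb{R}^d\to(-\infty,\infty]$, $\partial f$ is the convex subdifferential, norms are Euclidean, and $1/0=\infty$, so $L(0)=\infty$. $f$ is $(\beta,0)$-Hölder smooth if $\|g_x-g_y\|\le\beta$ for all $x,y\in\mathbb{R}^d$, $g_x\in\partial f(x)$, $g_y\in\partial f(y)$. $f$ is $L(\cdot)$-inexactly smooth if for all $x,y\in\mathbb{R}^d$, $g_x\in\partial f(x)$, $\delta\ge 0$: $f(y)\le f(x)+\langle g_x,y-x\rangle+\frac{L(\delta)}{2}\|y-x\|^2+\delta$ (nothing is imposed when $L(\delta)=\infty$). A function $f$ interpolates $\mathcal{H}$ if $f(x_i)=f_i$ and $g_i\in\partial f(x_i)$ for all $i\in\mathcal{I}$. $\mathcal{H}$ is $L(\cdot)$-interpolable if it is interpolated by some convex $L(\cdot)$-inexactly smooth function. *)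

(* Defs.v *)
From HB Require Import structures.
From mathcomp Require Import all_boot all_order all_algebra.
From mathcomp Require Import all_classical all_reals all_analysis.

Set Implicit Arguments.
Unset Strict Implicit.
Unset Printing Implicit Defensive.

Import Order.TTheory GRing.Theory Num.Theory.
Import numFieldNormedType.Exports.

Local Open Scope classical_set_scope.
Local Open Scope ring_scope.

(* The library's norm on 'rV[R]_d is the sup norm, hence [enorm].  The topology
   on 'rV[R]_d is the product topology, i.e. the Euclidean one. *)
Definition dot (R : realType) (d : nat) (u v : 'rV[R]_d) : R :=
  \sum_(i < d) u 0 i * v 0 i.

Definition enorm (R : realType) (d : nat) (u : 'rV[R]_d) : R :=
  Num.sqrt (dot u u).

Section ConvexFunctions.
Variables (R : realType) (d : nat).
Implicit Types (f : 'rV[R]_d -> \bar R) (x y g : 'rV[R]_d).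
Local Open Scope ereal_scope.

Definition proper f : Prop :=
  (forall x, f x != -oo) /\ (exists x, f x != +oo).

(* No indeterminate sum arises when f avoids -oo, and 0 * +oo = 0. *)
Definition ereal_convex f : Prop :=
  forall x y (t : R), (0 <= t <= 1)%R ->
    f (t *: x + (1 - t) *: y)%R <= t%:E * f x + (1 - t)%:E * f y.

Definition epigraph f : set ('rV[R]_d * R) := [set p | f p.1 <= p.2%:E].

Definition closed_convex_proper f : Prop :=
  [/\ closed (epigraph f), ereal_convex f & proper f].

(* For proper f this is empty at points where f is +oo. *)
Definition subdifferential f x : set 'rV[R]_d :=
  [set g | forall y, f x + (dot g (y - x))%:E <= f y].

Definition holder_smooth0 (beta : R) f : Prop :=
  forall x y gx gy, subdifferential f x gx -> subdifferential f y gy ->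
    (enorm (gx - gy) <= beta)%R.

(* Only the values of L on [0, +oo[ matter. *)
Definition inexactly_smooth (L : R -> \bar R) f : Prop :=
  forall x y gx (delta : R), subdifferential f x gx -> (0 <= delta)%R ->
    L delta != +oo ->
    f y <= f x + (dot gx (y - x))%:E
           + L delta / 2%:E * (enorm (y - x) ^+ 2)%:E + delta%:E.

Definition interpolates (I : Type) (x : I -> 'rV[R]_d) (fv : I -> R)
    (g : I -> 'rV[R]_d) f : Prop :=
  forall i, f (x i) = (fv i)%:E /\ subdifferential f (x i) (g i).

Definition holder0_interpolable (beta : R) (I : Type) (x : I -> 'rV[R]_d)
    (fv : I -> R) (g : I -> 'rV[R]_d) : Prop :=
  exists f, [/\ closed_convex_proper f, holder_smooth0 beta f &
                interpolates x fv g f].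

Definition L_interpolable (L : R -> \bar R) (I : Type) (x : I -> 'rV[R]_d)
    (fv : I -> R) (g : I -> 'rV[R]_d) : Prop :=
  exists f, [/\ closed_convex_proper f, inexactly_smooth L f &
                interpolates x fv g f].

End ConvexFunctions.

(* Main.v *)
(* (i) => (ii).  If y is arbitrary and p is the proximal point of y with step
   lam, then (y - p) / lam is a subgradient at p, hence at distance at most beta
   from g_x; so p tends to y as lam tends to 0, and closedness of f gives
   f(y) <= f(x) + <g_x, y - x> + beta |y - x| (in particular f is finite).
   AM-GM turns this into inexact smoothness.
   (ii) => (iii).  Optimizing delta, f grows from x_i in the direction
   v = g_j - g_i at most with slope <g_i, v> + beta |v|, and at least with slope
   <g_j, v>, so |v|^2 <= beta |v|.
   (iii) => (i).  Take f(z) = sup_j f_j + <g_j, z - x_j>.  Any subgradient h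
   satisfies <h, v> <= sup_j <g_j, v>, so that two of them, h and k, satisfy
   <h - k, v> <= sup_{j,l} <g_j - g_l, v> <= beta |v|. *)
Require Import Defs.
From HB Require Import structures.
From mathcomp Require Import all_boot all_order all_algebra.
From mathcomp Require Import all_classical all_reals all_analysis.
From mathcomp Require Import ring lra.

Set Implicit Arguments.
Unset Strict Implicit.
Unset Printing Implicit Defensive.

Import Order.TTheory GRing.Theory Num.Theory.
Import numFieldNormedType.Exports.

Local Open Scope classical_set_scope.
Local Open Scope ring_scope.

(** * Euclidean inner product and norm *)

Section Euclidean.
Variables (R : realType) (d : nat).
Implicit Types (u v w : 'rV[R]_d).

Lemma dotC u v : dot u v = dot v u.
Proof. by apply: eq_bigr => i _; rewrite mulrC. Qed.

Lemma dotDl u v w : dot (u + v) w = dot u w + dot v w.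
Proof. by rewrite -big_split; apply: eq_bigr => i _; rewrite mxE mulrDl. Qed.

Lemma dotZl (a : R) u v : dot (a *: u) v = a * dot u v.
Proof. by rewrite mulr_sumr; apply: eq_bigr => i _; rewrite mxE mulrA. Qed.

Lemma dotNl u v : dot (- u) v = - dot u v.
Proof. by rewrite -scaleN1r dotZl mulN1r. Qed.

Lemma dotDr u v w : dot u (v + w) = dot u v + dot u w.
Proof. by rewrite dotC dotDl !(dotC u). Qed.

Lemma dotZr (a : R) u v : dot u (a *: v) = a * dot u v.
Proof. by rewrite dotC dotZl dotC. Qed.

Lemma dotNr u v : dot u (- v) = - dot u v.
Proof. by rewrite dotC dotNl dotC. Qed.

Definition dotE := (dotDl, dotDr, dotNl, dotNr, dotZl, dotZr).

Lemma dot_ge0 u : 0 <= dot u u.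
Proof. by apply: sumr_ge0 => i _; rewrite -expr2 sqr_ge0. Qed.

Lemma enorm_ge0 u : 0 <= enorm u.
Proof. exact: sqrtr_ge0. Qed.

Lemma sqr_enorm u : enorm u ^+ 2 = dot u u.
Proof. by rewrite sqr_sqrtr // dot_ge0. Qed.

Lemma enormZ (a : R) u : enorm (a *: u) = `|a| * enorm u.
Proof.
by rewrite /enorm !dotE mulrA -expr2 sqrtrM ?sqr_ge0 // sqrtr_sqr.
Qed.

Lemma enormN u : enorm (- u) = enorm u.
Proof. by rewrite -scaleN1r enormZ normrN1 mul1r. Qed.

Lemma sqr_dot_le u v : dot u v ^+ 2 <= dot u u * dot v v.
Proof.
have [v0|v_neq0] := eqVneq (dot v v) 0.
  rewrite v0 mulr0; have [->|uv0] := eqVneq (dot u v) 0; first by rewrite expr0n.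
  (* Since [dot v v = 0], the squared norm of [u - c *: v] is affine in [c]; this coefficient makes
     it [-1]. *)
  have := dot_ge0 (u - ((dot u u + 1) / (2 * dot u v)) *: v).
  rewrite !dotE v0 (dotC v u).
  have -> : dot u u - (dot u u + 1) / (2 * dot u v) * dot u v +
     (- ((dot u u + 1) / (2 * dot u v) * dot u v) -
      (dot u u + 1) / (2 * dot u v) * - ((dot u u + 1) / (2 * dot u v) * 0))
    = -1 by field.
  by lra.
have v_gt0 : 0 < dot v v by rewrite lt_def v_neq0 dot_ge0.
have := dot_ge0 (dot v v *: u - dot u v *: v).
rewrite !dotE (dotC v u).
set a := dot u u; set b := dot u v; set c := dot v v.
move=> h.
suff : 0 <= c * (a * c - b ^+ 2) by rewrite pmulr_rge0 // subr_ge0.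
by apply: le_trans h _; rewrite le_eqVlt; apply/orP; left; apply/eqP; ring.
Qed.

Lemma dot_le_enorm u v : dot u v <= enorm u * enorm v.
Proof.
rewrite /enorm -sqrtrM ?dot_ge0 //; apply: le_trans (ler_norm _) _.
by rewrite -sqrtr_sqr ler_wsqrtr // sqr_dot_le.
Qed.

Lemma enormD u v : enorm (u + v) <= enorm u + enorm v.
Proof.
rewrite -(ler_pXn2r (n := 2)) ?nnegrE ?addr_ge0 ?enorm_ge0 //.
rewrite sqrrD !sqr_enorm !dotE (dotC v u).
have := dot_le_enorm u v; rewrite mulr2n; lra.
Qed.

(** Transfers Euclidean bounds to the coordinatewise balls and boxes of the product topology. *)
Lemma abs_coord_le_enorm u i : `|u 0 i| <= enorm u.
Proof.
rewrite -sqrtr_sqr ler_wsqrtr // /dot (bigD1 i) //= -expr2 lerDl.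
by apply: sumr_ge0 => j _; rewrite -expr2 sqr_ge0.
Qed.

Lemma continuous_dot (T : topologicalType) (a b : T -> 'rV[R]_d) :
  continuous a -> continuous b -> continuous (fun z => dot (a z) (b z)).
Proof.
move=> ca cb; apply: continuous_big => [|i _ z]; first exact: add_continuous.
apply: cvgM.
  exact: (continuous_comp (ca z) (@coord_continuous _ _ _ 0 i (a z))).
exact: (continuous_comp (cb z) (@coord_continuous _ _ _ 0 i (b z))).
Qed.

End Euclidean.

(** * Proximal points and the growth of Hölder smooth functions *)

Section ClosedConvexFunctions.
Variables (R : realType) (d : nat).
Implicit Types (f : 'rV[R]_d -> \bar R) (x y g : 'rV[R]_d).

Lemma subdifferential_fin f x g : Defs.proper f -> subdifferential f x g ->
  exists r : R, f x = r%:E.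
Proof.
move=> [fNy [z fz]] fg; case E : (f x) => [r| |]; first by exists r.
- by have := fg z; rewrite E /= leye_eq (negbTE fz).
- by have := fNy x; rewrite E.
Qed.

Lemma ge0_of_vanishing_slope (A B : R) : 0 <= B ->
  (forall t, 0 < t <= 1 -> 0 <= A + t * B) -> 0 <= A.
Proof.
move=> B0 h; rewrite leNgt; apply/negP => A0.
have BA : 0 < B - A by lra.
(* For [A < 0] this [t] makes [A + t * B] equal to [- A ^+ 2 / (B - A)], which is negative. *)
have /h : 0 < - A / (B - A) <= 1.
  by rewrite divr_gt0 ?ler_pdivrMr //; lra.
apply/negP; rewrite -ltNge.
have -> : A + - A / (B - A) * B = - (A ^+ 2 / (B - A)).
  by field; rewrite gt_eqF.
by rewrite oppr_lt0 divr_gt0 // exprn_even_gt0 //= lt_eqF.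
Qed.

Lemma closed_of_approx (A : set ('rV[R]_d * R)) (y : 'rV[R]_d) (v C : R) :
  closed A ->
  (forall l, 0 < l -> exists p t, [/\ A (p, t), enorm (y - p) <= l * C &
     `|v - t| <= l * C]) -> A (y, v).
Proof.
move=> cA h; apply: cA => B /nbhs_ballP[e /= e0 eB].
pose l := e / (`|C| + 1).
have l0 : 0 < l by rewrite divr_gt0 // ltr_wpDl.
have lC : l * C < e.
  apply: (le_lt_trans (ler_wpM2l (ltW l0) (ler_norm C))).
  by rewrite /l -mulrA gtr_pMr // mulrC ltr_pdivrMr ?ltr_wpDl // mul1r ltrDl.
have [p [t [Apt yp vt]]] := h _ l0.
exists (p, t); split => //; apply: eB; split => /=.
  split=> // i j; rewrite (ord1 i); apply: le_lt_trans lC.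
  rewrite /ball_ /=; apply: le_trans yp.
  by have := abs_coord_le_enorm (y - p) j; rewrite !mxE.
exact: le_lt_trans vt lC.
Qed.

(* The minimization is over the epigraph, since f itself is only lower
   semicontinuous; g keeps the sublevel sets of the objective bounded. *)
Lemma prox_exists f x g y (lam : R) : closed_convex_proper f ->
    subdifferential f x g -> 0 < lam ->
  exists p (s : R), f p = s%:E /\
    forall z t, epigraph f (z, t) ->
      s + dot (p - y) (p - y) / (2 * lam) <= t + dot (z - y) (z - y) / (2 * lam).
Proof.
move=> [cf _ pf] fg lam0; have [r fx] := subdifferential_fin pf fg.
pose phi (q : 'rV[R]_d * R) := q.2 + dot (q.1 - y) (q.1 - y) / (2 * lam).
(* Completing the square: the minorant [r + dot g (z - x)] plus the proximal term is a quadratic in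
   [z] centred at [c]. Points no worse than [x] thus lie within [rho] of [c], where Cauchy-Schwarz
   bounds the minorant below by [m]. *)
pose c := y - lam *: g.
pose rho := enorm (x - c).
pose m := r - enorm g * rho + dot g (c - x).
pose box := [set v : 'rV[R]_d | forall i, `[c 0 i - rho, c 0 i + rho]%classic (v ord0 i)].
pose K := epigraph f `&` (box `*` `[m, phi (x, r)]%classic).
(* The compact set [K] contains the whole sublevel set, so a minimizer on [K] is global. *)
have inK q : epigraph f q -> phi q <= phi (x, r) -> K q.
  case: q => z t zt h.
  have tge : r + dot g (z - x) <= t.
    by have := le_trans (fg z) zt; rewrite fx -EFinD lee_fin.
  have zc : enorm (z - c) <= rho.
    rewrite /rho /enorm ler_wsqrtr //.
    have : 2 * lam * (r + dot g (z - x)) + dot (z - y) (z - y)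
         <= 2 * lam * r + dot (x - y) (x - y).
      move: h; rewrite /phi /= => h.
      have /(ler_wpM2l (ltW (mulr_gt0 (ltr0n R 2) lam0))) :
        r + dot g (z - x) + dot (z - y) (z - y) / (2 * lam) <=
        r + dot (x - y) (x - y) / (2 * lam) by apply: le_trans h; rewrite lerD2r.
      by rewrite !(mulrDr (2 * lam)) !(mulrCA (2 * lam) (dot _ _))
        !divff ?mulr1 // mulf_neq0 // gt_eqF.
    rewrite /c !dotE (dotC g z) (dotC g y) (dotC g x) (dotC y z) (dotC y x).
    by lra.
  split=> //; split=> /=.
    move=> i; rewrite /= in_itv /=.
    have := le_trans (abs_coord_le_enorm (z - c) i) zc.
    by rewrite !mxE ler_norml; lra.
  rewrite in_itv /=; apply/andP; split.
    apply: le_trans tge; rewrite /m.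
    have -> : z - x = (c - x) - (c - z) by rewrite opprB [RHS]addrC addrA subrK.
    rewrite [dot g (_ - (c - z))]dotDr dotNr.
    have := dot_le_enorm g (c - z); rewrite -opprB enormN.
    have := ler_wpM2l (enorm_ge0 g) zc; lra.
  apply: le_trans h; rewrite /phi /= lerDl divr_ge0 ?dot_ge0 //.
  by rewrite mulr_ge0 // ltW.
have xK : K (x, r) by apply: inK => //; rewrite /epigraph /= fx.
have cK : compact K.
  have cbox : compact (box `*` `[m, phi (x, r)]%classic).
    apply: compact_setX; last exact: segment_compact.
    apply: (@rV_compact R d (fun i => `[c 0 i - rho, c 0 i + rho]%classic)) => i.
    exact: segment_compact.
  apply: (@subclosed_compact _ _ (box `*` `[m, phi (x, r)]%classic)).
  - apply: closedI => //; apply: (compact_closed _ cbox).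
    exact: (@norm_hausdorff _ ('rV[R]_d * R)%type).
  - exact: cbox.
  - by move=> q [].
have [| |[p s]] := @compact_EVT_min _ _ phi K _ cK.
- by exists (x, r).
- apply: continuous_subspaceT => q.
  apply: cvgD; first exact: cvg_snd.
  apply: cvgM; last exact: cvg_cst.
  have cs : continuous (fun q : 'rV[R]_d * R => q.1 - y).
    by move=> q'; apply: cvgB; [exact: cvg_fst|exact: cvg_cst].
  exact: (continuous_dot cs cs).
rewrite inE => psK pmin.
have pmin' q : epigraph f q -> phi (p, s) <= phi q.
  move=> fq; have [h|/ltW h] := leP (phi q) (phi (x, r)).
    by apply: pmin; rewrite inE; exact: inK.
  by apply: le_trans h; apply: pmin; rewrite inE.
exists p, s; split; last by move=> z t /pmin'.
(* The minimizer lies on the graph: lowering its height to [f p] stays in the epigraph and cannot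
   decrease [phi]. *)
have fps : (f p <= s%:E)%E by case: psK.
case E : (f p) fps => [s'| |] // fps; last by have := pf.1 p; rewrite E.
congr EFin; apply/eqP; rewrite eq_le -lee_fin fps /=.
have /pmin' : epigraph f (p, s') by rewrite /epigraph /= E.
by rewrite /phi /= lerD2r.
Qed.

(** First-order optimality: compare [p] with [a *: z + (1 - a) *: p], bound [f] there by convexity,
    divide by [a] and let [a] tend to 0; the quadratic remainder vanishes. *)
Lemma prox_subgradient f x g y (lam : R) : closed_convex_proper f ->
    subdifferential f x g -> 0 < lam ->
  exists p (s : R), f p = s%:E /\ subdifferential f p (lam^-1 *: (y - p)).
Proof.
move=> hf fg lam0; have [p [s [fp pmin]]] := prox_exists y hf fg lam0.
have [_ cvxf pf] := hf.
exists p, s; split => // z; case E : (f z) => [t| |]; last first.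
- by have := pf.1 z; rewrite E.
- by rewrite leey.
rewrite fp -EFinD lee_fin -subr_ge0.
set A := (X in 0 <= X).
apply: (@ge0_of_vanishing_slope A (dot (z - p) (z - p) / (2 * lam))).
  by rewrite divr_ge0 ?dot_ge0 // mulr_ge0 // ltW.
move=> a /andP[a0 a1].
have /pmin : epigraph f (a *: z + (1 - a) *: p, a * t + (1 - a) * s).
  rewrite /epigraph /=; apply: (le_trans (cvxf z p a _)); first by rewrite ltW.
  by rewrite E fp -!EFinM -EFinD.
have -> : a *: z + (1 - a) *: p - y = (p - y) + a *: (z - p).
  by apply/rowP => i; rewrite !mxE; ring.
rewrite /A -(pmulr_rge0 _ a0) -subr_ge0.
rewrite (dotDl (p - y) (a *: (z - p))) !(dotDr _ (p - y)) !dotZl !dotZr.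
rewrite -(opprB p y) !dotNl (dotC (z - p) (p - y)).
move: (dot (p - y) (p - y)) (dot (p - y) (z - p)) (dot (z - p) (z - p)) => u v w.
move=> /le_trans; apply; rewrite le_eqVlt; apply/orP; left; apply/eqP.
by field; rewrite gt_eqF.
Qed.

(** As [f y] is not known to be finite beforehand, the bound is obtained as membership of [(y, V)]
    in the closed epigraph. *)
Lemma holder_smooth0_le beta f x g y : closed_convex_proper f ->
    holder_smooth0 beta f -> subdifferential f x g ->
  (f y <= f x + (dot g (y - x) + beta * enorm (y - x))%:E)%E.
Proof.
move=> hf hb fg; have [cf _ pf] := hf.
have [r fx] := subdifferential_fin pf fg.
have beta0 : 0 <= beta := le_trans (enorm_ge0 _) (hb _ _ _ _ fg fg).
rewrite fx -EFinD.
pose D := beta + enorm g.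
have D0 : 0 <= D by rewrite addr_ge0 ?enorm_ge0.
pose V := r + (dot g (y - x) + beta * enorm (y - x)).
(* [D] bounds the norm of the subgradient at the proximal point [p], so [y - p] has norm at most
   [l * D]; replacing [y] by [p] in [V] then costs at most [l * (D * D)]. *)
apply: (@closed_of_approx (epigraph f) y V (D + D * D) cf) => l l0.
have [p [s [fp fgp]]] := prox_subgradient y hf fg l0.
have gpg := hb _ _ _ _ fgp fg.
have yp : enorm (y - p) <= l * D.
  have -> : y - p = l *: (l^-1 *: (y - p)) by rewrite scalerA divff ?scale1r ?gt_eqF.
  rewrite enormZ gtr0_norm // ler_pM2l //.
  rewrite -[X in enorm X](subrK g) (le_trans (enormD _ _)) // lerD2r //.
exists p, (V + l * (D * D)); split.
- rewrite /epigraph /= fp lee_fin.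
  have := fgp x; rewrite fp fx -EFinD lee_fin.
  set gp := l^-1 *: _ in gpg *.
  rewrite -(opprB p x) dotNr => sle.
  have := dot_le_enorm (gp - g) (p - x).
  rewrite dotDl dotNl => h1.
  have h2 := ler_wpM2r (enorm_ge0 (p - x)) gpg.
  have px : p - x = (y - x) + - (y - p).
    by rewrite opprB [RHS]addrC addrA subrK.
  have h3 : enorm (p - x) <= enorm (y - x) + l * D.
    by rewrite px (le_trans (enormD _ _)) // enormN lerD2l.
  have h4 : dot g (p - x) <= dot g (y - x) + enorm g * (l * D).
    rewrite px dotDr lerD2l; apply: (le_trans (dot_le_enorm _ _)).
    by rewrite enormN ler_wpM2l ?enorm_ge0.
  have h5 := ler_wpM2l beta0 h3.
  have -> : l * (D * D) = beta * (l * D) + enorm g * (l * D) by rewrite /D; ring.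
  by move: h5; rewrite /V mulrDr; lra.
- by apply: (le_trans yp); rewrite ler_pM2l // lerDl mulr_ge0.
- rewrite opprD addrA subrr sub0r normrN ger0_norm.
    by rewrite ler_pM2l // lerDr.
  by rewrite !mulr_ge0 // ltW.
Qed.

End ClosedConvexFunctions.

(** * Inexact smoothness and distances between subgradients *)

Section Interpolation.
Variables (R : realType) (d : nat).

Definition quadratic_modulus (beta delta : R) : \bar R :=
  ((beta ^+ 2)%:E / (2 * delta)%:E)%E.

Lemma quadratic_modulus0 (beta : R) : 0 < beta -> quadratic_modulus beta 0 = +oo%E.
Proof.
by move=> b0; rewrite /quadratic_modulus mulr0 inve0 gt0_muley // lte_fin exprn_gt0.
Qed.

Lemma quadratic_modulusE (beta delta : R) : 0 < delta ->
  quadratic_modulus beta delta = (beta ^+ 2 / (2 * delta))%:E.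
Proof.
move=> d0; rewrite /quadratic_modulus inver ifF -?EFinM //.
by rewrite gt_eqF // mulr_gt0.
Qed.

Lemma holder_smooth0_inexactly_smooth (beta : R) (f : 'rV[R]_d -> \bar R) :
    0 < beta -> closed_convex_proper f -> holder_smooth0 beta f ->
  inexactly_smooth (quadratic_modulus beta) f.
Proof.
move=> beta0 hf hb x y g delta fg; rewrite le_eqVlt => /predU1P[<-|delta0 _].
  (* At [delta = 0] the modulus is [+oo], so nothing is imposed. *)
  by rewrite quadratic_modulus0.
have [_ _ pf] := hf; have [r fx] := subdifferential_fin pf fg.
apply: (le_trans (holder_smooth0_le y hf hb fg)).
rewrite quadratic_modulusE // fx inver ifF; last by rewrite pnatr_eq0.
rewrite -!EFinM -!EFinD lee_fin.
set n := enorm _.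
(* AM-GM: the gap is the square [(beta n - 2 delta)^2 / (4 delta)] *)
have -> : r + dot g (y - x) + beta ^+ 2 / (2 * delta) / 2 * n ^+ 2 + delta
  = r + (dot g (y - x) + beta * n) + (beta * n - 2 * delta) ^+ 2 / (4 * delta).
  by field; rewrite gt_eqF.
by rewrite lerDl divr_ge0 ?sqr_ge0 // mulr_ge0 // ltW.
Qed.

Lemma inexactly_smooth_subgradient_dist (beta : R) (f : 'rV[R]_d -> \bar R)
    x y g h (r s : R) :
    0 < beta -> inexactly_smooth (quadratic_modulus beta) f ->
    f x = r%:E -> f y = s%:E ->
    subdifferential f x g -> subdifferential f y h ->
  enorm (h - g) <= beta.
Proof.
move=> beta0 hL fx fy fg fh; rewrite leNgt; apply/negP => lt_beta.
set v := h - g in lt_beta *.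
have n0 : 0 < enorm v := lt_trans beta0 lt_beta.
pose k := enorm v * (enorm v - beta).
have k0 : 0 < k by rewrite mulr_gt0 // subr_gt0.
(* Along the ray [x + a *: v] the lower bound from [h] outgrows the upper bound from [g] at rate
   [k > 0], which is absurd for large [a]. *)
have grow (a : R) : 0 < a -> a * k <= r - s - dot h (x - y).
  move=> a0; pose z := x + a *: v.
  have := fh z; rewrite fy -EFinD => le1.
  (* This is the optimal [delta]: the quadratic term and [delta] are then equal, with sum
     [beta * enorm (z - x)]. *)
  have delta0 : 0 < beta * (a * enorm v) / 2 by rewrite divr_gt0 // !mulr_gt0.
  have := hL x z g _ fg (ltW delta0).
  rewrite quadratic_modulusE // fx inver ifF; last by rewrite pnatr_eq0.
  move=> /(_ isT) /(le_trans le1).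
  rewrite -!EFinM -!EFinD lee_fin.
  have -> : z - x = a *: v by rewrite /z addrC addKr.
  have -> : z - y = (x - y) + a *: v by rewrite /z addrAC.
  rewrite enormZ gtr0_norm // dotDr !dotZr.
  have -> : beta ^+ 2 / (2 * (beta * (a * enorm v) / 2)) / 2 * (a * enorm v) ^+ 2
     = beta * (a * enorm v) / 2 by field; rewrite !gt_eqF.
  have : dot h v - dot g v = enorm v ^+ 2 by rewrite sqr_enorm {3}/v dotDl dotNl.
  move=> e; rewrite /k.
  have -> : dot h v = dot g v + enorm v ^+ 2 by rewrite -e; ring.
  lra.
have := grow ((`|r - s - dot h (x - y)| + 1) / k) (divr_gt0 (ltr_wpDl (normr_ge0 _) ltr01) k0).
rewrite divfK ?gt_eqF //; have := ler_norm (r - s - dot h (x - y)); lra.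
Qed.

(** * The supremum of the affine minorants as interpolant *)

Section MaxAffine.
Variables (I : Type) (x : I -> 'rV[R]_d) (fv : I -> R) (g : I -> 'rV[R]_d).
Variables (beta : R) (i0 : I).
Hypothesis data : forall i j,
  fv j + dot (g j) (x i - x j) <= fv i /\ enorm (g i - g j) <= beta.

Let aff j z := fv j + dot (g j) (z - x j).

Definition max_affine (z : 'rV[R]_d) : \bar R :=
  ereal_sup (range (fun j => (fv j + dot (g j) (z - x j))%:E)).

Lemma max_affine_le z (v : \bar R) :
  (max_affine z <= v)%E <-> forall j, ((aff j z)%:E <= v)%E.
Proof.
split=> [h j|h]; last by apply: ge_ereal_sup => _ [j _ <-]; exact: h.
by apply: le_trans h; apply: ereal_sup_ubound; exists j.
Qed.

Lemma aff_le_max_affine j z : ((aff j z)%:E <= max_affine z)%E.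
Proof. by have /max_affine_le := lexx (max_affine z). Qed.

Lemma affD j z w : aff j (z + w) = aff j z + dot (g j) w.
Proof. by rewrite /aff addrAC dotDr addrA. Qed.

Lemma max_affine_node i : max_affine (x i) = (fv i)%:E.
Proof.
apply/eqP; rewrite eq_le; apply/andP; split.
  by apply/max_affine_le => j; rewrite lee_fin; have [] := data i j.
have := aff_le_max_affine i (x i).
by rewrite /aff subrr -(scale0r 0) dotZr mul0r addr0.
Qed.

(** At [x i0] every minorant is at most [fv i0], and every slope is within [beta] of [g i0]; this
    bounds all of them at [z] uniformly. *)
Lemma max_affine_fin z : exists r : R, max_affine z = r%:E.
Proof.
have : (max_affine z <= (fv i0 + dot (g i0) (z - x i0)
                         + beta * enorm (z - x i0))%:E)%E.
  apply/max_affine_le => j; rewrite lee_fin.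
  rewrite -{1}(subrK (x i0) z) addrC affD.
  have [h1 _] := data i0 j; have [_ h2] := data j i0.
  have h3 := dot_le_enorm (g j - g i0) (z - x i0).
  have h4 := ler_wpM2r (enorm_ge0 (z - x i0)) h2.
  by move: h1 h3; rewrite /aff dotDl dotNl; lra.
have := aff_le_max_affine i0 z.
by case: (max_affine z) => [r| |] //; exists r.
Qed.

Lemma max_affine_interpolates : interpolates x fv g max_affine.
Proof.
move=> i; split; first exact: max_affine_node.
by move=> y; rewrite max_affine_node -EFinD; exact: aff_le_max_affine.
Qed.

Lemma max_affine_closed_convex_proper : closed_convex_proper max_affine.
Proof.
split.
- have -> : epigraph max_affine = \bigcap_j [set p | aff j p.1 - p.2 <= 0].
    apply/seteqP; split=> -[z t] /=.
      by move=> /max_affine_le h j _ /=; rewrite subr_le0 -lee_fin.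
    by move=> h; apply/max_affine_le => j; rewrite lee_fin -subr_le0; exact: h.
  apply: closed_bigI => j _.
  apply: (preimage_closed (f := fun p : 'rV[R]_d * R => aff j p.1 - p.2)
    _ (@closed_le R 0)) => p _.
  apply: cvgB; last exact: cvg_snd.
  apply: cvgD; first exact: cvg_cst.
  have cx : continuous (fun q : 'rV[R]_d * R => q.1 - x j).
    by move=> q; apply: cvgB; [exact: cvg_fst|exact: cvg_cst].
  have cg : continuous (fun _ : 'rV[R]_d * R => g j).
    by move=> q; exact: cvg_cst.
  exact: (continuous_dot cg cx).
- move=> y z t /andP[t0 t1]; apply/max_affine_le => j.
  have [r1 e1] := max_affine_fin y; have [r2 e2] := max_affine_fin z.
  have := aff_le_max_affine j y; have := aff_le_max_affine j z.
  rewrite e1 e2 -!EFinM -EFinD !lee_fin => h2 h1.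
  have -> : aff j (t *: y + (1 - t) *: z) = t * aff j y + (1 - t) * aff j z.
    by rewrite /aff !dotE; ring.
  by rewrite lerD // ler_wpM2l // subr_ge0.
- split; last exists (x i0).
    by move=> z; have [r ->] := max_affine_fin z.
  by rewrite max_affine_node.
Qed.

(** The supremum need not be attained, hence the slack [e]: pick [j] within [e] of the supremum at
    [y + v] and use that the same minorant lies below it at [y]. *)
Lemma max_affine_subgradient y h v (e : R) : subdifferential max_affine y h ->
  0 < e -> exists j, dot h v < dot (g j) v + e.
Proof.
move=> hy e0; have [r1 e1] := max_affine_fin y.
have [r2 e2] := max_affine_fin (y + v).
have := hy (y + v); rewrite [y + v - y]addrC addKr e1 e2 -EFinD lee_fin => le_r.
have [_ [j _ <-]] : exists2 u, range (fun j => (aff j (y + v))%:E) u &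
    (max_affine (y + v) - e%:E < u)%E.
  by apply: ub_ereal_sup_adherent => //; rewrite -/(max_affine (y + v)) e2.
rewrite e2 -EFinB lte_fin affD.
have := aff_le_max_affine j y; rewrite e1 lee_fin => h1 h2.
by exists j; lra.
Qed.

Lemma max_affine_holder_smooth0 : holder_smooth0 beta max_affine.
Proof.
move=> y z h k hy kz; set v := h - k.
have key : enorm v ^+ 2 <= beta * enorm v.
  apply/ler_addgt0Pr => e e0; have e2 : 0 < e / 2 by rewrite divr_gt0.
  have [j hj] := max_affine_subgradient v hy e2.
  have [l kl] := max_affine_subgradient (- v) kz e2.
  have h1 := dot_le_enorm (g j - g l) v.
  have [_ /(ler_wpM2r (enorm_ge0 v)) h2] := data j l.
  have : enorm v ^+ 2 = dot h v - dot k v by rewrite sqr_enorm {1}/v dotDl dotNl.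
  by move: hj kl h1; rewrite !dotNr dotDl dotNl; lra.
(* Cancelling [enorm v] requires it to be positive; otherwise [0 <= beta] suffices. *)
have [n0|] := ltP 0 (enorm v); first by rewrite -(ler_pM2r n0) -expr2.
by move=> n0; apply: (le_trans n0); have [_] := data i0 i0; apply: le_trans;
  exact: enorm_ge0.
Qed.

End MaxAffine.

End Interpolation.

(* Division is that of \bar R, for which 1 / 0 = +oo. *)
Theorem theorem3p5 (R : realType) (d : nat) (beta : R) (hbeta : 0 < beta)
    (I : Type) (x : I -> 'rV[R]_d) (fv : I -> R) (g : I -> 'rV[R]_d) :
  [<-> holder0_interpolable beta x fv g;
       L_interpolable
         (fun delta : R => ((beta ^+ 2)%:E / (2 * delta)%:E)%E) x fv g;
       forall i j : I, fv j + dot (g j) (x i - x j) <= fv i /\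
                       enorm (g i - g j) <= beta].
Proof.
tfae.
- move=> [f [hf hb hi]]; exists f; split => //.
  exact: holder_smooth0_inexactly_smooth.
- move=> [f [hf hL hi]] i j.
  have [fi gi] := hi i; have [fj gj] := hi j; split.
    by have := gj (x i); rewrite fi fj -EFinD lee_fin.
  exact: (inexactly_smooth_subgradient_dist hbeta hL fj fi gj gi).
- move=> data; case: (pselect (inhabited I)) => [[i0]|noI].
    exists (max_affine x fv g); split.
    + exact: (max_affine_closed_convex_proper i0 data).
    + exact: (max_affine_holder_smooth0 i0 data).
    + exact: (max_affine_interpolates data).
  (* Over an empty index type the supremum would be [-oo], which is not proper; a single zero
     observation yields the zero function instead. *)
  pose zero (_ : unit) := 0 : 'rV[R]_d.
  have data0 (i j : unit) : 0 + dot (zero j) (zero i - zero j) <= 0 :> R /\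
      enorm (zero i - zero j) <= beta.
    rewrite /zero subrr add0r /enorm -(scale0r 0) !dotZl !mul0r sqrtr0.
    by split => //; exact: ltW.
  exists (max_affine zero (fun=> 0) zero); split.
  + exact: (max_affine_closed_convex_proper tt data0).
  + exact: (max_affine_holder_smooth0 tt data0).
  + by move=> i; case: noI.
Qed.
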